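(* Let $\mathcal{L}$ be a set of lines of the generalized quadrangle $\mathrm{Q}(4,q)$ with the property that every line of $\mathrm{Q}(4,q)$ meets at least one line of $\mathcal{L}$. If $|\mathcal{L}|$ is smaller than the size of the smallest non-trivial blocking set of $\mathrm{PG}(2,q)$, then $\mathcal{L}$ contains the pencil of $q+1$ lines through a point of $\mathrm{Q}(4,q)$, or $\mathcal{L}$ contains a regulus contained in $\mathrm{Q}(4,q)$.
   Context: Here $q$ is a prime power. $\mathrm{Q}(4,q)$ is the non-singular parabolic quadric of $\mathrm{PG}(4,q)$, regarded as a generalized quadrangle of order $(q,q)$: its points are the points of the quadric and its lines are the lines of $\mathrm{PG}(4,q)$ completely contained in the quadric. Two lines meet if they share at least one point (so a line meets itself). A blocking set of $\mathrm{PG}(2,q)$ is a set of points meeting every line of $\mathrm{PG}(2,q)$; it is non-trivial if it contains no line. A regulus contained in $\mathrm{Q}(4,q)$ is one of the two families of $q+1$ pairwise disjoint lines of a hyperbolic quadric $\mathrm{Q}^+(3,q)$ that is the intersection of $\mathrm{Q}(4,q)$ with a hyperplane of $\mathrm{PG}(4,q)$. *)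

(* Defs.v *)
From mathcomp Require Export all_boot all_order all_algebra.
From mathcomp Require Export finmap.
Set Implicit Arguments.
Unset Strict Implicit.
Unset Printing Implicit Defensive.
Import GRing.Theory.
Local Open Scope ring_scope.

(* PG(n, q) is the lattice of subspaces of 'rV[F]_(n + 1), with F the field of
   q elements; projective dimension is vector dimension minus one. *)

Definition is_point (F : finFieldType) n (U : {vspace 'rV[F]_n}) : bool :=
  \dim U == 1.

Definition is_line (F : finFieldType) n (U : {vspace 'rV[F]_n}) : bool :=
  \dim U == 2.

Definition lines_meet (F : finFieldType) n (l m : {vspace 'rV[F]_n}) : Prop :=
  exists p : {vspace 'rV[F]_n}, [/\ is_point p, (p <= l)%VS & (p <= m)%VS].

Definition is_blocking_set (F : finFieldType) (B : {fset {vspace 'rV[F]_3}}) :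
    Prop :=
  (forall p, p \in B -> is_point p) /\
  (forall l : {vspace 'rV[F]_3}, is_line l ->
     exists2 p, p \in B & (p <= l)%VS).

Definition is_nontrivial_blocking_set (F : finFieldType)
    (B : {fset {vspace 'rV[F]_3}}) : Prop :=
  is_blocking_set B /\
  ~ (exists2 l : {vspace 'rV[F]_3}, is_line l &
       forall p, is_point p -> (p <= l)%VS -> p \in B).

(* PG(2, 2) has no non-trivial blocking set, so the minimum is a relation
   rather than a number. *)
Definition is_smallest_nontrivial_blocking_set (F : finFieldType)
    (B : {fset {vspace 'rV[F]_3}}) : Prop :=
  is_nontrivial_blocking_set B /\
  (forall B' : {fset {vspace 'rV[F]_3}},
     is_nontrivial_blocking_set B' -> (#|` B| <= #|` B'|)%N).

(* Every quadratic form on 'rV[F]_n arises from some (not necessarily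
   symmetric) matrix A, in any characteristic. *)
Definition qform (F : finFieldType) n (A : 'M[F]_n) (v : 'rV[F]_n) : F :=
  \sum_(i < n) \sum_(j < n) A i j * v 0 i * v 0 j.

Definition qpolar (F : finFieldType) n (A : 'M[F]_n) (u v : 'rV[F]_n) : F :=
  qform A (u + v) - qform A u - qform A v.

(* The quadric has no singular point.  In characteristic 2 the polar form may
   be degenerate off the quadric: for n = 5 it always is. *)
Definition nonsingular (F : finFieldType) n (A : 'M[F]_n) : Prop :=
  forall u : 'rV[F]_n, u != 0 -> qform A u = 0 ->
    exists v : 'rV[F]_n, qpolar A u v != 0.

Definition on_quadric (F : finFieldType) n (A : 'M[F]_n)
    (U : {vspace 'rV[F]_n}) : Prop :=
  forall v, v \in U -> qform A v = 0.

(* The points and lines of Q(4, q), the non-singular quadric of PG(4, q) with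
   equation qform A = 0. *)
Definition is_Q4_point (F : finFieldType) (A : 'M[F]_5)
    (p : {vspace 'rV[F]_5}) : Prop :=
  is_point p /\ on_quadric A p.

Definition is_Q4_line (F : finFieldType) (A : 'M[F]_5)
    (l : {vspace 'rV[F]_5}) : Prop :=
  is_line l /\ on_quadric A l.

(* H is a hyperplane which meets the quadric in a Q+(3, q): in suitable
   coordinates of H the points of the intersection are those of the quadric
   x0 x1 + x2 x3 = 0. *)
Definition is_hyperbolic_section (F : finFieldType) (A : 'M[F]_5)
    (H : {vspace 'rV[F]_5}) : Prop :=
  exists2 e : 4.-tuple 'rV[F]_5, basis_of H e &
    forall x : 'rV[F]_4,
      qform A (\sum_(i < 4) x 0 i *: tnth e i) = 0 <->
      x 0 (inord 0) * x 0 (inord 1) + x 0 (inord 2) * x 0 (inord 3) = 0.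

(* Distinct lines of Q+(3, q) are disjoint exactly when they lie in the same
   family, so q + 1 pairwise disjoint lines form one whole family. *)
Definition is_regulus_in_Q4 (F : finFieldType) (A : 'M[F]_5)
    (R : {fset {vspace 'rV[F]_5}}) : Prop :=
  exists2 H : {vspace 'rV[F]_5}, is_hyperbolic_section A H &
    [/\ #|` R| = #|F|.+1,
        forall l, l \in R -> is_Q4_line A l /\ (l <= H)%VS &
        forall l m, l \in R -> m \in R -> l != m -> ~ lines_meet l m].

(* Main.v *)
From HB Require Import structures.
From Stdlib Require Import Classical.
From mathcomp Require Import ring.
Require Import Defs.
Set Implicit Arguments.
Unset Strict Implicit.
Unset Printing Implicit Defensive.
Import GRing.Theory.
Local Open Scope ring_scope.

(** The lines of Q(4,q) are the points of PG(3,q) in disguise, because Q(4,q)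
    is the dual of the symplectic quadrangle W(3,q).  The duality is realised
    by the spin representation: a linear map S from the quadratic space of
    dimension 5 to the 4 x 4 matrices with S(v)^2 = k Q(v), k != 0, whose
    values are self-adjoint for the symplectic form symp.  For a nonzero
    spinor a, the vectors v with a S(v) = 0 form a line spin_line S a of the
    quadric, every line of the quadric arises so (spin_line_surj), and lines
    that meet come from orthogonal spinors (meet_symp).

    Choose a spinor for each line of L.  As every plane of PG(3,q) is the
    polar plane of some point b, and the line of b meets some line of L, the
    chosen points block all planes of PG(3,q).  Any set of points that blocks
    all planes, and that is smaller than the smallest non-trivial planar
    blocking set B, contains a line (small_solid_blocking).  Indeed, projecting
    from a point p outside the set gives a planar blocking set that is too small
    to be non-trivial, so some plane through p holds at least q of the points.
    These points block all lines of that plane: through an unblocked line there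
    would be q further planes, each with a point of its own, so at least 2q
    points in total, whereas B has at most 2q points (smallest_leq_2q).  Being too small
    to be non-trivial, they contain a line.

    It remains to translate back a line <a, b> of PG(3,q).  If symp a b = 0,
    its points are the lines of the quadric through one point
    (pencil_of_isotropic_line).  Otherwise they are pairwise disjoint lines of
    the quadric, all in one solid that meets the quadric in a hyperbolic
    quadric (regulus_of_hyperbolic_line).

    The map S is written down explicitly once the form is, up to a scalar,
    x0 x1 + x2 x3 + x4^2.  A Witt-type argument (quadric_normal_form) gives
    these coordinates from a line on the quadric.  If there is no such line,
    any point of the quadric satisfies the first alternative vacuously, and
    there is one because every quadratic form in five variables over a finite
    field has a nontrivial zero (isotropic_vector). *)

(** * Subspaces given by matrices *)

(** Subspaces in the statement are elements of {vspace _}, but the rank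
    computations below are made with matrices; this passes between the two. *)
Definition rowspan (F : fieldType) m n (A : 'M[F]_(m, n)) : {vspace 'rV[F]_n} :=
  limg (linfun (mulmxr A : 'rV[F]_m -> 'rV[F]_n)).

Lemma mem_rowspan (F : fieldType) m n (A : 'M[F]_(m, n)) v :
  (v \in rowspan A) = (v <= A)%MS.
Proof.
apply/memv_imgP/submxP => [[w _ ->]|[w ->]]; exists w; rewrite ?memvf ?lfunE //.
Qed.

Lemma rowspan_le (F : fieldType) m m' n (A : 'M[F]_(m, n)) (C : 'M_(m', n)) :
  (rowspan A <= rowspan C)%VS = (A <= C)%MS.
Proof.
apply/subvP/rV_subP => H v; have := H v; rewrite !mem_rowspan //.
Qed.

Lemma dim_rowspan (F : fieldType) m n (A : 'M[F]_(m, n)) :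
  \dim (rowspan A) = \rank A.
Proof.
have -> : rowspan A = rowspan (row_base A).
  by apply/eqP; rewrite eqEsubv !rowspan_le !eq_row_base submx_refl.
rewrite limg_dim_eq ?dimvf ?dim_matrix; first exact: mul1n.
apply/eqP; rewrite -subv0; apply/subvP => v; rewrite memv_cap memv_ker lfunE /=.
by rewrite memv0 mulmx_free_eq0 ?row_base_free // => /andP[].
Qed.

Lemma rowspanP (F : fieldType) n (U : {vspace 'rV[F]_n}) :
  exists2 A : 'M[F]_(\dim U, n), row_free A & U = rowspan A.
Proof.
pose A := \matrix_(i < \dim U) tnth (vbasis U) i.
have UA : U = rowspan A.
  apply/vspaceP => v; rewrite mem_rowspan; apply/idP/submxP => [Uv|[w ->]].
    exists (\row_i coord (vbasis U) i v).
    rewrite mulmx_sum_row {1}(coord_vbasis Uv); apply: eq_bigr => i _.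
    by rewrite mxE rowK (tnth_nth 0).
  rewrite mulmx_sum_row; apply: memv_suml => i _; rewrite rowK memvZ //.
  by rewrite vbasis_mem // mem_tnth.
by exists A => //; rewrite /row_free -dim_rowspan -UA.
Qed.

Lemma rowspanP_dim (F : fieldType) n r (U : {vspace 'rV[F]_n}) :
  \dim U == r -> exists2 A : 'M[F]_(r, n), row_free A & U = rowspan A.
Proof. by move/eqP <-; apply: rowspanP. Qed.

(** Unlike with col_base and row_base, the inner dimension is the given number
    r, so that no cast is needed when the rank is known. *)
Lemma rank_factor (F : fieldType) m n r (A : 'M[F]_(m, n)) : \rank A = r ->
  exists2 C : 'M[F]_(m, r), row_full C &
  exists2 D : 'M[F]_(r, n), row_free D & A = C *m D.
Proof.
move<-; exists (col_base A); first exact: col_base_full.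
by exists (row_base A); rewrite ?row_base_free ?mulmx_base.
Qed.

Lemma rank_col (F : fieldType) n (g : 'cV[F]_n) : \rank g = (g != 0).
Proof. by rewrite -mxrank_tr rank_rV trmx_eq0. Qed.

Lemma memv_rV (F : fieldType) n (u v : 'rV[F]_n) :
  (u \in <[v]>%VS) = (u <= v)%MS.
Proof. by apply/vlineP/sub_rVP. Qed.

Lemma vline_eq (F : fieldType) n (u v : 'rV[F]_n) :
  u != 0 -> (u <= v)%MS -> <[u]>%VS = <[v]>%VS.
Proof.
move=> u0 uv; apply/eqP; rewrite eqEdim -memvE memv_rV uv !dim_vline u0.
by case: (v != 0).
Qed.

Lemma line_functional (F : finFieldType) (l : {vspace 'rV[F]_3}) : is_line l ->
  exists2 g : 'cV[F]_3, g != 0 & forall v, (v \in l) = (v *m g == 0).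
Proof.
case/rowspanP_dim => A /eqP rA ->.
have [|C Cfull [D Dfree DE]] := @rank_factor F 3%N 3%N 1%N (cokermx A).
  by rewrite mxrank_coker rA.
exists C => [|v]; last by rewrite mem_rowspan submxE DE mulmxA mulmx_free_eq0.
by rewrite -mxrank_eq0 (eqP Cfull).
Qed.

Lemma kernel_is_line (F : finFieldType) (g : 'cV[F]_3) :
  g != 0 -> is_line (rowspan (kermx g)).
Proof. by move=> g0; rewrite /is_line dim_rowspan mxrank_ker rank_col g0. Qed.

Lemma mem_kernel (F : fieldType) m n (A : 'M[F]_(m, n)) v :
  (v \in rowspan (kermx A)) = (v *m A == 0).
Proof. by rewrite mem_rowspan sub_kermx. Qed.

Lemma pointP (F : finFieldType) n (p : {vspace 'rV[F]_n}) :
  is_point p -> exists2 v, v != 0 & p = <[v]>%VS.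
Proof.
case/rowspanP_dim => v; rewrite /row_free rank_rV => v0 ->; exists v.
  by case: (v =P 0) v0.
by apply/vspaceP => u; rewrite mem_rowspan memv_rV.
Qed.

Lemma span2P (F : fieldType) n (u w v : 'rV[F]_n) :
  reflect (exists al be, v = al *: u + be *: w) (v <= col_mx u w)%MS.
Proof.
rewrite -addsmxE; apply: (iffP sub_addsmxP) => [[[a b] ->]|[al [be ->]]].
  by exists (a 0 0), (b 0 0); rewrite -!mul_scalar_mx -!mx11_scalar.
by exists (al%:M, be%:M); rewrite /= !mul_scalar_mx.
Qed.

Lemma free2P (F : fieldType) n (u w : 'rV[F]_n) :
  reflect (forall al be, al *: u + be *: w = 0 -> al = 0 /\ be = 0)
    (row_free (col_mx u w)).
Proof.
rewrite -kermx_eq0; apply: (iffP idP) => [/eqP H al be uw|H].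
  have : row_mx al%:M be%:M *m col_mx u w = 0.
    by rewrite mul_row_col !mul_scalar_mx.
  move/sub_kermxP; rewrite H submx0 => /eqP; rewrite -row_mx0 => /eq_row_mx[].
  have inj (x : F) : x%:M = 0 :> 'M_1 -> x = 0.
    by move/(congr1 (fun M : 'M_1 => M 0 0)); rewrite !mxE eqxx.
  by move=> /inj-> /inj->.
apply/rowV0P => x /sub_kermxP; rewrite -[x]hsubmxK mul_row_col.
rewrite [lsubmx x]mx11_scalar [rsubmx x]mx11_scalar !mul_scalar_mx => /H[-> ->].
by rewrite !raddf0 row_mx0.
Qed.

Lemma free2_neq0 (F : fieldType) n (u w : 'rV[F]_n) :
  row_free (col_mx u w) -> u != 0.
Proof.
move/free2P => uw; apply/eqP => u0; have [] := uw 1 0.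
  by rewrite u0 scaler0 scale0r addr0.
by move/eqP; rewrite oner_eq0.
Qed.

Lemma span2l (F : fieldType) n (u w : 'rV[F]_n) : (u <= col_mx u w)%MS.
Proof. by apply/span2P; exists 1, 0; rewrite scale1r scale0r addr0. Qed.

Lemma span2r (F : fieldType) n (u w : 'rV[F]_n) : (w <= col_mx u w)%MS.
Proof. by apply/span2P; exists 0, 1; rewrite scale1r scale0r add0r. Qed.

Lemma rank2_basis (F : fieldType) m n (A : 'M[F]_(m, n)) : \rank A = 2%N ->
  exists u : 'rV_n, exists2 w : 'rV_n,
    row_free (col_mx u w) & (A :=: col_mx u w)%MS.
Proof.
case/(@rank_factor _ _ _ (1 + 1)%N) => C Cfull [D Dfree ->].
exists (usubmx D), (dsubmx D); rewrite vsubmxK //.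
exact: eqmxMfull.
Qed.

(** * Blocking sets in terms of vectors *)

(** Points are represented by nonzero vectors, and a hyperplane by a nonzero
    linear form g, of which it is the kernel. *)
Definition blocks (F : finFieldType) n (X : {set 'rV[F]_n}) :=
  (forall x, x \in X -> x != 0) /\
  forall g : 'cV[F]_n, g != 0 -> exists2 x, x \in X & x *m g = 0.

(** The condition is v <= x rather than v = x because any nonzero multiple of v
    represents the same point. *)
Definition covers (F : finFieldType) n (X : {set 'rV[F]_n}) m
    (U : 'M[F]_(m, n)) :=
  forall v : 'rV_n, (v <= U)%MS -> v != 0 -> exists2 x, x \in X & (v <= x)%MS.

Definition points_of (F : finFieldType) n (X : {set 'rV[F]_n}) :
  {fset {vspace 'rV[F]_n}} := [fset <[x]>%VS | x in X]%fset.

Lemma card_points_of (F : finFieldType) n (X : {set 'rV[F]_n}) :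
  (#|` points_of X| <= #|X|)%N.
Proof.
rewrite /points_of; apply: leq_trans (leq_imfset_card _ _ _) _.
by rewrite cardE /enum_mem size_filter.
Qed.

Lemma mem_points_of (F : finFieldType) n (X : {set 'rV[F]_n}) p :
  p \in points_of X -> exists2 x, x \in X & p = <[x]>%VS.
Proof. by case/imfsetP => x /= xX ->; exists x. Qed.

Lemma in_points_of (F : finFieldType) n (X : {set 'rV[F]_n}) x :
  x \in X -> <[x]>%VS \in points_of X.
Proof. by move=> xX; apply/imfsetP; exists x. Qed.

Lemma points_of_blocking (F : finFieldType) (X : {set 'rV[F]_3}) :
  blocks X -> is_blocking_set (points_of X).
Proof.
case=> X0 Xb.
split=> [p /mem_points_of[x /X0 x0 ->]|l /line_functional[g g0 lg]].
  by rewrite /is_point dim_vline x0.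
have [x xX xg] := Xb g g0; exists <[x]>%VS; first exact: in_points_of.
by rewrite -memvE lg xg.
Qed.

(** The minimality of B, restated for sets of vectors so that subspaces need not
    be handled where it is applied. *)
Lemma smallest_leq (F : finFieldType) (B : {fset {vspace 'rV[F]_3}})
    (X : {set 'rV[F]_3}) : is_smallest_nontrivial_blocking_set B ->
  blocks X -> (forall g : 'cV[F]_3, g != 0 -> ~ covers X (kermx g)) ->
  (#|` B| <= #|X|)%N.
Proof.
move=> [_ Bmin] Xb Xnt; apply: leq_trans (card_points_of X); apply: Bmin.
split; first exact: points_of_blocking.
case=> l ll Xl; have [g g0 lg] := line_functional ll; apply: (Xnt g g0) => v.
rewrite sub_kermx -lg => vl v0.
have [||x xX vx] := mem_points_of (Xl <[v]>%VS _ _); rewrite -?memvE //.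
  by rewrite /is_point dim_vline v0.
by exists x; rewrite // -memv_rV -vx memv_line.
Qed.

Lemma small_planar_blocking (F : finFieldType) (B : {fset {vspace 'rV[F]_3}})
    (X : {set 'rV[F]_3}) : is_smallest_nontrivial_blocking_set B ->
  blocks X -> (#|X| < #|` B|)%N ->
  exists2 g : 'cV[F]_3, g != 0 & covers X (kermx g).
Proof.
move=> Bs Xb XB; apply: NNPP => nX.
suff: (#|` B| <= #|X|)%N by rewrite leqNgt XB.
by apply: smallest_leq Bs Xb _ => g g0 Xg; apply: nX; exists g.
Qed.

(** The complement of a non-trivial blocking set B is again one: it meets every
    line because B contains none, and it contains no line because B meets every
    line. The q^3 - 1 nonzero vectors are split between the two. *)
Lemma double_smallest_leq (F : finFieldType) (B : {fset {vspace 'rV[F]_3}}) :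
  is_smallest_nontrivial_blocking_set B -> (2 * #|` B| <= #|F| ^ 3)%N.
Proof.
move=> Bs; have [[[Bp Bb] Bnt] _] := Bs.
pose X := [set v : 'rV[F]_3 | (v != 0) && (<[v]>%VS \notin B)].
pose X' := [set v : 'rV[F]_3 | (v != 0) && (<[v]>%VS \in B)].
have XB : (#|` B| <= #|X|)%N.
  apply: smallest_leq Bs _ _; first split=> [x|g g0].
  - by rewrite inE => /andP[].
  - apply: NNPP => nX; apply: Bnt; exists (rowspan (kermx g)).
      exact: kernel_is_line.
    move=> _ /pointP[v v0 ->]; rewrite -memvE mem_kernel => /eqP vg.
    apply/negP => /negP vB; apply: nX; exists v => //.
    by rewrite inE vB v0.
  - move=> g g0 Xg; have [p pB pg] := Bb _ (kernel_is_line g0).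
    have /pointP[v v0 pv] := Bp p pB.
    have vg : (v <= kermx g)%MS by rewrite -mem_rowspan memvE -pv.
    have [x xX vx] := Xg v vg v0; move: xX; rewrite inE -(vline_eq v0 vx) -pv pB.
    by rewrite andbF.
have X'B : (#|` B| <= #|X'|)%N.
  apply: leq_trans (card_points_of X'); apply/fsubset_leq_card/fsubsetP => p pB.
  have /pointP[v v0 pv] := Bp p pB.
  by rewrite pv; apply: in_points_of; rewrite inE v0 -pv.
have dis : [disjoint X & X'].
  by apply/pred0P => v; rewrite !inE /=; case: (_ \in B); rewrite !(andbF, andbT).
have <- : #|'rV[F]_3| = (#|F| ^ 3)%N by rewrite card_mx mul1n.
rewrite mul2n -addnn; apply: leq_trans (leq_add XB X'B) _.
by rewrite -cardUI (eqP (_ : #|[predI X & X']| == 0%N)) ?addn0 ?max_card.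
Qed.

(** * The smallest non-trivial blocking set has at most 2q points *)

Definition vec3 (F : nzRingType) (a b c : F) : 'rV[F]_3 := \row_j [:: a; b; c]`_j.

Lemma vec3_mul (F : fieldType) (a b c : F) (g : 'cV[F]_3) :
  vec3 a b c *m g = 0 <-> a * g 0 0 + b * g 1 0 + c * g 2%:R 0 = 0.
Proof.
have -> : a * g 0 0 + b * g 1 0 + c * g 2%:R 0 = (vec3 a b c *m g) 0 0.
  rewrite !mxE !big_ord_recl big_ord0 !mxE /= addr0 addrA.
  by do ![congr (_ + _)]; congr (_ * g _ _); apply/val_inj.
split=> [->|H]; first by rewrite mxE.
by rewrite [LHS]mx11_scalar H raddf0.
Qed.

(** For q > 2, remove the point R = <(0, 0, 1)> from the line x0 = 0 and add one
    point on each of the q other lines through R, not all collinear.  This is a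
    non-trivial blocking set of 2q points.  The added points are
    <(1, s, f s)>, where f is the indicator of s = 0; being collinear would make
    f affine, which fails as soon as there is a third element c of F.  For q = 2
    every function on F is affine, and the previous bound is used instead. *)
Lemma smallest_leq_2q (F : finFieldType) (B : {fset {vspace 'rV[F]_3}}) :
  is_smallest_nontrivial_blocking_set B -> (#|` B| <= 2 * #|F|)%N.
Proof.
move=> Bs; have q1 : (1 < #|F|)%N := card_finNzRing_gt1 F.
case: (ltnP 2 #|F|) => [q2|]; last first.
  move=> q2; have {q1 q2}q2 : #|F| = 2%N by apply/eqP; rewrite eqn_leq q2.
  have := double_smallest_leq Bs; rewrite q2 => H.
  by rewrite -(leq_pmul2l (isT : 0 < 2)%N).
have [c c0 c1] : exists2 c : F, c != 0 & c != 1.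
  have : (0 < #|~: [set (0 : F)%R; 1%R]|)%N.
    by rewrite cardsCs setCK subn_gt0 cards2; apply: leq_ltn_trans q2; case: eqP.
  by case/card_gt0P => c; rewrite !inE negb_or => /andP[c0 c1]; exists c.
pose X := [set vec3 0 1 t | t : F] :|: [set vec3 1 s (s == 0)%:R | s : F].
have vec3_1 (a b d : F) : vec3 a b d 0 (inord 1) = b by rewrite mxE /= inordK.
have vec3_0 (a b d : F) : vec3 a b d 0 (inord 0) = a by rewrite mxE /= inordK.
have vec3_2 (a b d : F) : vec3 a b d 0 (inord 2) = d by rewrite mxE /= inordK.
have XE : (#|X| <= 2 * #|F|)%N.
  rewrite mul2n -addnn (leq_trans (leq_card_setU _ _)) //.
  by rewrite leq_add // leq_imset_card.
apply: leq_trans XE; apply: smallest_leq Bs _ _.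
  split=> [x|g g0].
    case/setUP => /imsetP[t _ ->]; apply/eqP => /rowP.
      by move/(_ (inord 1)); rewrite vec3_1 mxE; apply/eqP/oner_neq0.
    by move/(_ (inord 0)); rewrite vec3_0 mxE; apply/eqP/oner_neq0.
  have [g2|g2] := eqVneq (g 2%:R 0) 0; last first.
    exists (vec3 0 1 (- g 1 0 / g 2%:R 0)); first by rewrite inE imset_f.
    by apply/vec3_mul; field.
  have [g1|g1] := eqVneq (g 1 0) 0.
    exists (vec3 0 1 0); first by rewrite inE imset_f.
    by apply/vec3_mul; rewrite g1 g2; ring.
  exists (vec3 1 (- g 0 0 / g 1 0) (- g 0 0 / g 1 0 == 0)%:R).
    by rewrite inE orbC (imset_f (fun s : F => vec3 1 s (s == 0)%:R)).
  by apply/vec3_mul; rewrite g2; field.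
move=> g g0 Xg.
(* A covered line through R contains R, which X lacks. *)
have [g2|g2] := eqVneq (g 2%:R 0) 0.
  have [||x xX /sub_rVP[k vE]] := Xg (vec3 0 0 1).
  - by rewrite sub_kermx; apply/eqP/vec3_mul; rewrite g2; ring.
  - apply/eqP => /rowP/(_ (inord 2)); rewrite vec3_2 mxE.
    by apply/eqP/oner_neq0.
  have vE1 := congr1 (fun v : 'rV__ => v 0 (inord 1)) vE.
  have vE0 := congr1 (fun v : 'rV__ => v 0 (inord 0)) vE.
  have vE2 := congr1 (fun v : 'rV__ => v 0 (inord 2)) vE.
  have k0 : k = 0.
    by case/setUP: xX => /imsetP[t _ xE]; move: vE1 vE0;
      rewrite xE !mxE /= !inordK //= mulr1.
  by move/eqP: vE2; rewrite k0 !mxE !inordK //= mul0r oner_eq0.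
(* On a covered line that misses R, the indicator function would be affine. *)
have aff s : (s == 0)%:R = - (g 0 0 + s * g 1 0) / g 2%:R 0.
  have [||x xX /sub_rVP[k vE]] :=
    Xg (vec3 1 s (- (g 0 0 + s * g 1 0) / g 2%:R 0)).
  - by rewrite sub_kermx; apply/eqP/vec3_mul; field.
  - apply/eqP => /rowP/(_ (inord 0)); rewrite vec3_0 mxE.
    by apply/eqP/oner_neq0.
  have vE1 := congr1 (fun v : 'rV__ => v 0 (inord 1)) vE.
  have vE0 := congr1 (fun v : 'rV__ => v 0 (inord 0)) vE.
  have vE2 := congr1 (fun v : 'rV__ => v 0 (inord 2)) vE.
  case/setUP: xX => /imsetP[t _ xE]; move: vE1 vE0 vE2;
    rewrite xE !mxE /= !inordK //=.
    by rewrite mulr0 => _ /eqP; rewrite oner_eq0.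
  by rewrite mulr1 => -> <-; rewrite !mul1r.
have a0 := aff 0; have a1 := aff 1; have ac := aff c.
rewrite eqxx /= in a0; rewrite oner_eq0 /= in a1; rewrite (negPf c0) /= in ac.
have gE : g 1 0 = - g 0 0.
  apply/eqP; rewrite -addr_eq0; apply/eqP.
  transitivity (- (- (g 0 0 + 1 * g 1 0) / g 2%:R 0) * g 2%:R 0); first by field.
  by rewrite -a1 oppr0 mul0r.
have g00 : g 0 0 = - g 2%:R 0.
  by rewrite -[g 2%:R 0]mulr1 [X in - (_ * X)]a0; field.
have : 1 - c = 0 by rewrite [RHS]ac gE g00; field.
by apply/eqP; rewrite subr_eq0 eq_sym.
Qed.

(** * Sets of points that block the planes of PG(3,q) *)

(** The q vectors u + t w are pairwise non-proportional, so that their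
    representatives in X are distinct. *)
Lemma card_covers (F : finFieldType) n (X : {set 'rV[F]_n}) (u w : 'rV[F]_n) :
  row_free (col_mx u w) -> covers X (col_mx u w) ->
  (#|F| <= #|[set x in X | (x <= col_mx u w)%MS]|)%N.
Proof.
move=> /free2P uw Xuw.
have pt t : {x | x \in X & ((u + t *: w)%R <= x)%MS}.
  apply: sig2W; apply: (Xuw (u + t *: w)).
    by apply/span2P; exists 1, t; rewrite scale1r.
  by apply/eqP; rewrite -[u]scale1r => /uw[/eqP]; rewrite oner_eq0.
pose f t := s2val (pt t).
have fX t : f t \in X := s2valP (pt t).
have fE t : exists2 k, k != 0 & f t = k *: (u + t *: w).
  have /sub_rVP[k E] : ((u + t *: w)%R <= f t)%MS := s2valP' (pt t).
  have k0 : k != 0.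
    apply/eqP => k0; move: E; rewrite k0 scale0r -[u]scale1r => /uw[/eqP].
    by rewrite oner_eq0.
  by exists k^-1; rewrite ?invr_eq0 // E scalerA mulVf ?scale1r.
have injf : injective f.
  move=> t s; have [k k0 ->] := fE t; have [k' k'0 ->] := fE s.
  move=> /eqP; rewrite -subr_eq0 => /eqP E.
  have [] := uw (k - k') (k * t - k' * s).
    rewrite -[RHS]E !scalerBl !scalerDr !scalerA opprD !addrA; congr (_ + _).
    by rewrite -!addrA; congr (_ + _); rewrite addrC.
  move/eqP; rewrite subr_eq0 => /eqP <-.
  by rewrite -mulrBr => /eqP; rewrite mulf_eq0 (negPf k0) /= subr_eq0 => /eqP.
rewrite -(card_codom injf); apply/subset_leq_card/subsetP => _ /codomP[t ->].
rewrite inE fX; apply/span2P; have [k _ ->] := fE t.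
by exists k, (k * t); rewrite scalerDr scalerA.
Qed.

Lemma covers_leq (F : finFieldType) n (X : {set 'rV[F]_n}) m1 m2
    (U : 'M[F]_(m1, n)) (V : 'M[F]_(m2, n)) :
  (V <= U)%MS -> covers X U -> covers X V.
Proof. by move=> VU XU v vV; apply: XU; apply: submx_trans VU. Qed.

(** With P the projection from a point, P *m g defines the plane through that
    point which projects onto the line g = 0. *)
Lemma card_covers_plane (F : finFieldType) n (X : {set 'rV[F]_n})
    (P : 'M[F]_(n, 3)) (g : 'cV[F]_3) :
  g != 0 -> covers [set x *m P | x in X] (kermx g) ->
  (#|F| <= #|[set x in X | x *m (P *m g) == 0%R]|)%N.
Proof.
move=> g0 Xg.
have rk : \rank (kermx g) = 2%N by rewrite mxrank_ker rank_col g0.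
have [u [w fuw gE]] := rank2_basis rk.
have /card_covers H : covers [set x *m P | x in X] (col_mx u w).
  by apply: covers_leq Xg; rewrite gE.
apply: leq_trans (H fuw) _.
apply: leq_trans (leq_imset_card (mulmx^~ P) _).
apply/subset_leq_card/subsetP => z; rewrite inE -gE => /andP[/imsetP[x xX ->]].
move=> /sub_kermxP xg; apply/imsetP; exists x => //.
by rewrite inE xX mulmxA xg eqxx.
Qed.

(** Projection from a point outside X, and then a count of the planes through
    a line, reduce the claim to the same one for the plane. *)
Lemma small_solid_blocking (F : finFieldType) (B : {fset {vspace 'rV[F]_3}})
    (X : {set 'rV[F]_4}) : is_smallest_nontrivial_blocking_set B ->
  blocks X -> (#|X| < #|` B|)%N ->
  exists a : 'rV[F]_4, exists2 b : 'rV[F]_4,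
    row_free (col_mx a b) & covers X (col_mx a b).
Proof.
move=> Bs [X0 Xb] XB; have B2q := smallest_leq_2q Bs.
case: (classic (exists2 p : 'rV[F]_4, p != 0 &
   forall x, x \in X -> ~~ (p <= x)%MS)) => [[p p0 pX]|allX]; last first.
  have [|a [b fab _]] := @rank2_basis F 4%N 4%N (pid_mx 2).
    by rewrite rank_pid_mx.
  exists a, b => // v _ v0; apply: NNPP => nX; apply: allX; exists v => // x xX.
  by apply/negP => vx; apply: nX; exists x.
(* P is the projection from p onto a plane. *)
have [|P /row_fullP[P' P'P] [D Dfree pE]] := @rank_factor F 4%N 4%N 3%N (cokermx p).
  by rewrite mxrank_coker rank_rV p0.
have pP0 (x : 'rV_4) : x *m P = 0 -> (x <= p)%MS.
  by move=> xP; rewrite submxE pE mulmxA xP mul0mx.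
pose X1 := [set x *m P | x in X].
have X1b : blocks X1.
  split=> [_ /imsetP[x xX ->]|g g0].
    apply/eqP => /pP0/sub_rVP[k xE]; have := pX x xX; rewrite xE => /negP; apply.
    have k0 : k != 0 by apply: contraNneq (X0 x xX) => k0; rewrite xE k0 scale0r.
    by rewrite -[X in (X <= _)%MS]scale1r -(mulVf k0) -scalerA scalemx_sub.
  have [|x xX xg] := Xb (P *m g).
    by apply: contraNneq g0 => Pg; rewrite -[g]mul1mx -P'P -mulmxA Pg mulmx0.
  by exists (x *m P); [apply: imset_f|rewrite -mulmxA].
have X1B : (#|X1| < #|` B|)%N by apply: leq_ltn_trans (leq_imset_card _ _) XB.
have [g g0 X1g] := small_planar_blocking Bs X1b X1B.
pose f0 := P *m g; pose Y := [set x in X | x *m f0 == 0].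
have Yq : (#|F| <= #|Y|)%N by apply: card_covers_plane.
have f00 : f0 != 0.
  apply: contraNneq g0 => Pg.
  by rewrite -[g]mul1mx -P'P -mulmxA [P *m g]Pg mulmx0.
(* R embeds the projective plane onto the plane f0 = 0, and X2 is what X
   leaves in it. *)
have [|C /row_fullP[C' C'C] [R Rfree RE]] := @rank_factor F 4%N 4%N 3%N (kermx f0).
  by rewrite mxrank_ker rank_col f00.
have Rf0 : R *m f0 = 0.
  by rewrite -[R]mul1mx -C'C -[_ *m C *m R]mulmxA -RE -mulmxA mulmx_ker mulmx0.
have f0R (x : 'rV_4) : x *m f0 = 0 -> exists z, x = z *m R.
  move/sub_kermxP; rewrite RE => /submxP[z ->]; exists (z *m C).
  by rewrite mulmxA.
have [R' RR'] := row_freeP Rfree.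
pose X2 := [set z | z *m R \in X].
have X2E : (#|X2| <= #|X|)%N.
  have injR : injective (mulmx^~ R : 'rV_3 -> 'rV_4) by apply: row_free_inj.
  rewrite -(card_imset _ injR).
  apply/subset_leq_card/subsetP => _ /imsetP[z + ->].
  by rewrite inE.
have X2b : blocks X2.
  split=> [z|h h0].
    by rewrite inE => /X0; apply: contraNneq => ->; rewrite mul0mx.
  apply: NNPP => nX2.
  (* The planes through the unblocked line, other than f0 = 0, are
     f1 + t f0 = 0 with t in F. *)
  pose f1 := R' *m h.
  have pt t : {x | x \in X & x *m (f1 + t *: f0) = 0}.
    suff: exists x, (x \in X) && (x *m (f1 + t *: f0) == 0).
      by case/sigW => x /andP[xX /eqP xf]; exists x.
    have [|x xX xf] := Xb (f1 + t *: f0); last by exists x; rewrite xX xf eqxx.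
    apply: contraNneq h0 => /(congr1 (mulmx R)).
    rewrite mulmxDr -scalemxAr Rf0 scaler0 addr0 mulmxA RR' mul1mx mulmx0.
    by move=> ->.
  pose f t := s2val (pt t).
  have fX t : f t \in X := s2valP (pt t).
  have ff t : f t *m (f1 + t *: f0) = 0 := s2valP' (pt t).
  have fY t : f t *m f0 != 0.
    apply/eqP => ft; have [z zE] := f0R _ ft; apply: nX2; exists z.
      by rewrite inE -zE.
    move: (ff t); rewrite mulmxDr -scalemxAr ft scaler0 addr0 zE /f1.
    by rewrite -mulmxA [R *m _]mulmxA RR' mul1mx.
  have injf : injective f.
    move=> t s fts; have := ff t; rewrite fts => ft; have := ff s; rewrite -ft.
    rewrite !mulmxDr => /addrI/eqP; rewrite -!scalemxAr -subr_eq0 -scalerBl.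
    by rewrite scaler_eq0 (negPf (fY s)) orbF subr_eq0 => /eqP.
  have dis : [disjoint Y & codom f].
    apply/pred0P => x; rewrite !inE; apply/negP => /andP[/andP[_ xf]].
    by case/codomP => t xE; move: (fY t); rewrite -xE xf.
  suff: (2 * #|F| <= #|X|)%N by rewrite leqNgt (leq_trans XB B2q).
  rewrite mul2n -addnn (leq_trans (leq_add Yq (leqnn _))) //.
  rewrite -(card_codom injf) -cardUI.
  rewrite (eqP (_ : #|[predI Y & codom f]| == 0%N)) // addn0.
  apply/subset_leq_card/subsetP => x /orP[|/codomP[t ->] //].
  by rewrite inE => /andP[].
have [h h0 X2h] := small_planar_blocking Bs X2b (leq_ltn_trans X2E XB).
have rk : \rank (kermx h *m R) = 2%N.
  by rewrite mxrankMfree // mxrank_ker rank_col h0.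
have [a [b fab hE]] := rank2_basis rk; exists a, b => // v.
rewrite -hE => /submxP[z vE] v0.
have [||y yX vy] := X2h (z *m kermx h).
- exact: submxMl.
- by apply: contraNneq v0 => zh; rewrite vE mulmxA zh mul0mx.
exists (y *m R); first by rewrite inE in yX.
by rewrite vE mulmxA submxMr.
Qed.

(** * Quadratic forms over finite fields *)

Section Form.
Variables (F : finFieldType) (n : nat) (A : 'M[F]_n).
Implicit Types u v w : 'rV[F]_n.

Lemma qformE v : qform A v = (v *m A *m v^T) 0 0.
Proof.
rewrite /qform mxE exchange_big /=; apply: eq_bigr => j _.
by rewrite !mxE mulr_suml; apply: eq_bigr => i _; ring.
Qed.

Lemma qpolarE u v : qpolar A u v = (u *m (A + A^T) *m v^T) 0 0.
Proof.
have tr : u *m A^T *m v^T = v *m A *m u^T.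
  by rewrite [LHS]mx11_scalar -tr_scalar_mx -mx11_scalar !trmx_mul !trmxK mulmxA.
rewrite /qpolar !qformE mulmxDr mulmxDl tr linearD /= !(mulmxDl, mulmxDr) !mxE.
by ring.
Qed.

Lemma qpolarC u v : qpolar A u v = qpolar A v u.
Proof. by rewrite /qpolar [v + u]addrC; ring. Qed.

Lemma qpolarDl u v w : qpolar A (u + v) w = qpolar A u w + qpolar A v w.
Proof. by rewrite !qpolarE !mulmxDl mxE. Qed.

Lemma qpolarZl k v w : qpolar A (k *: v) w = k * qpolar A v w.
Proof. by rewrite !qpolarE -!scalemxAl mxE. Qed.

Lemma qpolarDr u v w : qpolar A w (u + v) = qpolar A w u + qpolar A w v.
Proof. by rewrite qpolarC qpolarDl !(qpolarC w). Qed.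

Lemma qpolarZr k v w : qpolar A w (k *: v) = k * qpolar A w v.
Proof. by rewrite qpolarC qpolarZl (qpolarC w). Qed.

Lemma qformZ k v : qform A (k *: v) = k ^+ 2 * qform A v.
Proof.
by rewrite !qformE linearZ /= -!scalemxAl -scalemxAr !mxE; ring.
Qed.

Lemma qformD u v : qform A (u + v) = qform A u + qform A v + qpolar A u v.
Proof. by rewrite /qpolar; ring. Qed.

Lemma qpolarvv v : qpolar A v v = 2%:R * qform A v.
Proof. by rewrite /qpolar -mulr2n -scaler_nat qformZ; ring. Qed.

End Form.

Definition form_simp := (qformD, qformZ, qpolarDl, qpolarDr, qpolarZl, qpolarZr).

(** The solutions of s linear equations form a space of dimension at least
    n - s > m, too large to lie in the span of m vectors. *)
Lemma orthogonal_outside (F : fieldType) n m s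
    (U : 'M[F]_(m, n)) (K : 'M[F]_(n, s)) :
  (m + s < n)%N -> exists2 v : 'rV[F]_n, v *m K = 0 & ~~ (v <= U)%MS.
Proof.
move=> msn; have : ~~ (kermx K <= U)%MS.
  apply: contraL msn => /mxrankS; rewrite mxrank_ker leq_subLR -leqNgt => H.
  by rewrite addnC (leq_trans H) // leq_add ?rank_leq_col ?rank_leq_row.
case/row_subPn => i iU; exists (row i (kermx K)) => //.
by apply/sub_kermxP/row_sub.
Qed.

(** A nonzero square has at most the two roots r and - r, while 0 has only
    one root. *)
Lemma squares_card (F : finFieldType) : (#|F| < 2 * #|[set x ^+ 2 | x : F]|)%N.
Proof.
pose S := [set x ^+ 2 | x : F]; pose S' := S :\ 0.
have r (s : F) : {x | (s \in S) ==> (x ^+ 2 == s)}.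
  have [sS|sS] := boolP (s \in S); last by exists 0.
  by apply/sigW; have /imsetP[x _ ->] := sS; exists x; rewrite eqxx.
pose f s := sval (r s).
have cov : [set: F] \subset 0 |: ((f @: S') :|: [set - f s | s in S']).
  apply/subsetP => x _; rewrite !inE; have [//|x0 /=] := eqVneq x 0.
  have xS0 : x ^+ 2 \in S by apply/imsetP; exists x.
  have xS : x ^+ 2 \in S' by rewrite in_setD1 sqrf_eq0 x0.
  have : f (x ^+ 2) ^+ 2 == x ^+ 2.
    exact: implyP (svalP (r (x ^+ 2))) xS0.
  rewrite eqf_sqr => /orP[/eqP xE|/eqP xE]; apply/orP; [left|right].
    by apply/imsetP; exists (x ^+ 2); rewrite ?xE.
  by apply/imsetP; exists (x ^+ 2); rewrite // -/(f _) xE opprK.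
have S0 : 0 \in S by apply/imsetP; exists 0; rewrite // expr0n.
have := subset_leq_card cov; rewrite cardsT => H.
rewrite -/S (cardsD1 0 S) S0 mul2n doubleD ltnS.
apply: leq_trans H _; apply: leq_trans (leq_card_setU _ _) _.
rewrite cards1 ltnS; apply: leq_trans (leq_card_setU _ _) _.
by rewrite -addnn leq_add // leq_imset_card.
Qed.

(** The sets of values of a x^2 and of - c - b y^2 each contain more than half
    of F, so they meet. *)
Lemma ternary_zero (F : finFieldType) (a b c : F) : a != 0 -> b != 0 ->
  exists x y, a * x ^+ 2 + b * y ^+ 2 + c = 0.
Proof.
move=> a0 b0; pose S := [set x ^+ 2 | x : F].
pose S1 := [set a * s | s in S]; pose S2 := [set - c - b * s | s in S].
have c1 : #|S1| = #|S| by apply: card_imset; apply: mulfI.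
have c2 : #|S2| = #|S|.
  by apply: card_imset => s t /addrI/oppr_inj; apply: mulfI.
have /set0Pn[z] : S1 :&: S2 != set0.
  rewrite -card_gt0; have := squares_card F; rewrite -/S => sq.
  have := cardsUI S1 S2; rewrite c1 c2 => UI.
  rewrite -(ltn_add2l #|S1 :|: S2|) UI addn0 addnn -mul2n.
  by apply: leq_ltn_trans sq; rewrite max_card.
rewrite inE => /andP[/imsetP[_ /imsetP[x _ ->] ->] /imsetP[_ /imsetP[y _ ->] E]].
by exists x, y; rewrite E; ring.
Qed.

(** Dimension 5 leaves room for three independent, pairwise orthogonal vectors,
    and on their span the form is diagonal.  This treats all characteristics
    alike. *)
Lemma isotropic_vector (F : finFieldType) (A : 'M[F]_5) :
  exists2 v : 'rV[F]_5, v != 0 & qform A v = 0.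
Proof.
pose G := A + A^T.
have [|e1 _ e1U] := @orthogonal_outside F 5%N 0%N 0%N 0 0; first by [].
have {e1U} e10 : e1 != 0 by apply: contraNneq e1U => ->; apply: sub0mx.
have [|e2 e2K e2U] := @orthogonal_outside F 5%N 1%N 1%N e1 (G *m e1^T); first by [].
have [|e3 e3K e3U] := @orthogonal_outside F 5%N (1 + 1)%N (1 + 1)%N
  (col_mx e1 e2) (row_mx (G *m e1^T) (G *m e2^T)).
  by [].
have {e2K} B21 : qpolar A e2 e1 = 0 by rewrite qpolarE -mulmxA e2K mxE.
move: e3K; rewrite mul_mx_row -row_mx0 => /eq_row_mx[e31 e32].
have {e31} B31 : qpolar A e3 e1 = 0 by rewrite qpolarE -mulmxA e31 mxE.
have {e32} B32 : qpolar A e3 e2 = 0 by rewrite qpolarE -mulmxA e32 mxE.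
have [q1|q1] := eqVneq (qform A e1) 0; first by exists e1.
have [q2|q2] := eqVneq (qform A e2) 0.
  by exists e2 => //; apply: contraNneq e2U => ->; apply: sub0mx.
have [x [y xy]] := ternary_zero (qform A e3) q1 q2.
exists (x *: e1 + y *: e2 + e3).
  apply: contraNneq e3U => /eqP; rewrite addrC addr_eq0 => /eqP ->.
  by apply/span2P; exists (- x), (- y); rewrite opprD !scaleNr.
rewrite !form_simp (qpolarC _ e1) (qpolarC _ e1 e3) (qpolarC _ e2 e3).
rewrite B21 B31 B32 -[RHS]xy.
ring.
Qed.

(** * Coordinates adapted to a line of the quadric *)

Lemma sum_ord5 (V : nmodType) (f : 'I_5 -> V) :
  \sum_i f i =
  f (inord 0) + f (inord 1) + f (inord 2) + f (inord 3) + f (inord 4).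
Proof.
rewrite !big_ord_recl big_ord0 /= addr0 !addrA.
by do ![congr (_ + _)]; congr f; apply/val_inj; rewrite /= inordK.
Qed.

Lemma sum_ord4 (V : nmodType) (f : 'I_4 -> V) :
  \sum_i f i = f (inord 0) + f (inord 1) + f (inord 2) + f (inord 3).
Proof.
rewrite !big_ord_recl big_ord0 /= addr0 !addrA.
by do ![congr (_ + _)]; congr f; apply/val_inj; rewrite /= inordK.
Qed.

Lemma ord4_ind (P : 'I_4 -> Prop) :
  P (inord 0) -> P (inord 1) -> P (inord 2) -> P (inord 3) -> forall i, P i.
Proof.
move=> P0 P1 P2 P3 i; rewrite -(inord_val i).
by case: i => -[|[|[|[|]]]].
Qed.

Lemma ord5_ind (P : 'I_5 -> Prop) :
  P (inord 0) -> P (inord 1) -> P (inord 2) -> P (inord 3) -> P (inord 4) ->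
  forall i, P i.
Proof.
move=> P0 P1 P2 P3 P4 i; rewrite -(inord_val i).
by case: i => -[|[|[|[|[|]]]]].
Qed.

Definition frame (F : nzRingType) n (e1 f1 e2 f2 g : 'rV[F]_n) : 'M[F]_(5, n) :=
  \matrix_(i < 5) [:: e1; f1; e2; f2; g]`_i.

Lemma mul_frame (F : fieldType) n (e1 f1 e2 f2 g : 'rV[F]_n) (x : 'rV[F]_5) :
  x *m frame e1 f1 e2 f2 g = x 0 (inord 0) *: e1 + x 0 (inord 1) *: f1 +
    x 0 (inord 2) *: e2 + x 0 (inord 3) *: f2 + x 0 (inord 4) *: g.
Proof. by rewrite mulmx_sum_row sum_ord5 !rowK !inordK. Qed.

Section Witt.
Variables (F : finFieldType) (A : 'M[F]_5).
Local Notation Q := (qform A).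
Local Notation B := (qpolar A).

(** Two orthogonal hyperbolic pairs of scale k, and a vector orthogonal to both.
    The scale is left free because the pairs are rescaled at the end. *)
Definition hyperbolic_frame k (e1 f1 e2 f2 g : 'rV[F]_5) :=
  [/\ [/\ Q e1 = 0, Q f1 = 0, Q e2 = 0 & Q f2 = 0],
      [/\ B e1 f1 = k & B e2 f2 = k],
      [/\ B e1 e2 = 0, B e1 f2 = 0, B f1 e2 = 0 & B f1 f2 = 0] &
      [/\ B g e1 = 0, B g f1 = 0, B g e2 = 0 & B g f2 = 0]].

Lemma qform_frame k e1 f1 e2 f2 g x : hyperbolic_frame k e1 f1 e2 f2 g ->
  Q (x *m frame e1 f1 e2 f2 g) =
  k * (x 0 (inord 0) * x 0 (inord 1) + x 0 (inord 2) * x 0 (inord 3)) +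
  Q g * x 0 (inord 4) ^+ 2.
Proof.
case=> [[q1 q2 q3 q4]] [h1 h2] [o1 o2 o3 o4] [g1 g2 g3 g4].
rewrite mul_frame !form_simp q1 q2 q3 q4 h1 h2 o1 o2 o3 o4.
rewrite !(qpolarC _ _ g) g1 g2 g3 g4; ring.
Qed.

Lemma hyperbolic_frame_unit k e1 f1 e2 f2 g : k != 0 -> g != 0 ->
  hyperbolic_frame k e1 f1 e2 f2 g -> frame e1 f1 e2 f2 g \in unitmx.
Proof.
move=> k0 g0 [[q1 q2 q3 q4]] [h1 h2] [o1 o2 o3 o4] [g1 g2 g3 g4].
rewrite -row_free_unit -kermx_eq0; apply/rowV0P => x /sub_kermxP.
rewrite mul_frame => xE.
have pair w : B (x 0 (inord 0) *: e1 + x 0 (inord 1) *: f1 +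
    x 0 (inord 2) *: e2 + x 0 (inord 3) *: f2 + x 0 (inord 4) *: g) w = 0.
  by rewrite xE -(scale0r 0) qpolarZl mul0r.
have k_eq0 y : y * k = 0 -> y = 0.
  by move/eqP; rewrite mulf_eq0 (negPf k0) orbF => /eqP.
have x0 : x 0 (inord 0) = 0.
  apply: k_eq0; rewrite -(pair f1) !form_simp h1 g2 qpolarvv q2.
  by rewrite (qpolarC _ e2) (qpolarC _ f2) o3 o4; ring.
have x1 : x 0 (inord 1) = 0.
  apply: k_eq0; rewrite -(pair e1) !form_simp (qpolarC _ f1) h1 g1 qpolarvv q1.
  by rewrite (qpolarC _ e2) (qpolarC _ f2) o1 o2; ring.
have x2 : x 0 (inord 2) = 0.
  by apply: k_eq0; rewrite -(pair f2) !form_simp h2 g4 qpolarvv q4 o2 o4; ring.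
have x3 : x 0 (inord 3) = 0.
  apply: k_eq0; rewrite -(pair e2) !form_simp (qpolarC _ f2) h2 g3 qpolarvv q3.
  by rewrite o1 o3; ring.
move: xE; rewrite x0 x1 x2 x3 !scale0r !add0r => /eqP.
rewrite scaler_eq0 (negPf g0) orbF => /eqP x4.
by apply/rowP; apply: ord5_ind; rewrite mxE.
Qed.

Hypothesis hA : nonsingular A.

Lemma hyperbolic_partner e : e != 0 -> Q e = 0 -> exists f, B e f = 1.
Proof.
move=> e0 qe; have [v v0] := hA e0 qe.
by exists ((B e v)^-1 *: v); rewrite qpolarZr mulVf.
Qed.

(** Non-singularity provides a vector pairing to 1 with each nonzero singular
    vector; the corrections below make it singular and orthogonal to the earlier ones.
    The vector e2 must change as well, to become orthogonal to the partner of
    e1.  The last vector is the component orthogonal to the two pairs of any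
    vector outside their span. *)
Lemma witt_basis (e1 e2 : 'rV[F]_5) :
    row_free (col_mx e1 e2) -> Q e1 = 0 -> Q e2 = 0 -> B e1 e2 = 0 ->
  exists e2' f1 f2 g, g != 0 /\ hyperbolic_frame 1 e1 f1 e2' f2 g.
Proof.
move=> e12 q1 q2 B12.
have e10 : e1 != 0 := free2_neq0 e12; move/free2P: e12 => e12.
have [v B1v] := hyperbolic_partner e10 q1.
have [e3 e3E] : exists e3, e3 = e2 + (- B e2 v) *: e1 by eexists.
have [f1 f1E] : exists f1, f1 = v + (- Q v) *: e1 by eexists.
have B11 : B e1 e1 = 0 by rewrite qpolarvv q1 mulr0.
have q3 : Q e3 = 0 by rewrite e3E !form_simp q2 q1 (qpolarC _ e2 e1) B12; ring.
have B13 : B e1 e3 = 0 by rewrite e3E !form_simp B12 B11; ring.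
have B3v : B e3 v = 0 by rewrite e3E !form_simp B1v; ring.
have e30 : e3 != 0.
  apply/eqP; rewrite e3E addrC -[e2]scale1r => /e12[_ /eqP].
  by rewrite oner_eq0.
have B1f : B e1 f1 = 1 by rewrite f1E !form_simp B1v B11; ring.
have qf1 : Q f1 = 0 by rewrite f1E !form_simp q1 (qpolarC _ v) B1v; ring.
have Bf3 : B f1 e3 = 0 by rewrite f1E !form_simp (qpolarC _ v) B3v B13; ring.
have Bff : B f1 f1 = 0 by rewrite qpolarvv qf1 mulr0.
have [w B3w] := hyperbolic_partner e30 q3.
have [w' w'E] : exists w', w' = w + (- B e1 w) *: f1 + (- B f1 w) *: e1.
  by eexists.
have [f2 f2E] : exists f2, f2 = w' + (- Q w') *: e3 by eexists.
have B3w' : B e3 w' = 1.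
  by rewrite w'E !form_simp B3w (qpolarC _ e3) Bf3 (qpolarC _ e3) B13; ring.
have B1w' : B e1 w' = 0 by rewrite w'E !form_simp B1f B11; ring.
have Bfw' : B f1 w' = 0.
  by rewrite w'E !form_simp Bff (qpolarC _ f1 e1) B1f; ring.
have B33 : B e3 e3 = 0 by rewrite qpolarvv q3 mulr0.
have B3f : B e3 f2 = 1 by rewrite f2E !form_simp B3w' B33; ring.
have qf2 : Q f2 = 0 by rewrite f2E !form_simp q3 (qpolarC _ w') B3w'; ring.
have B1f2 : B e1 f2 = 0 by rewrite f2E !form_simp B1w' B13; ring.
have Bff2 : B f1 f2 = 0 by rewrite f2E !form_simp Bfw' Bf3; ring.
have [|y _ yU] := @orthogonal_outside F 5%N 4%N 0%N
  (\matrix_(i < 4) [:: e1; f1; e3; f2]`_i) 0; first by [].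
have yE a b c d : y != a *: e1 + b *: f1 + c *: e3 + d *: f2.
  apply: contraNneq yU => ->; apply/submxP.
  exists (\row_i [:: a; b; c; d]`_i).
  by rewrite mulmx_sum_row sum_ord4 !rowK !mxE !inordK.
have [g gE] : exists g, g = y + (- B y f1) *: e1 + (- B y e1) *: f1 +
    (- B y f2) *: e3 + (- B y e3) *: f2 by eexists.
have f2f2 : B f2 f2 = 0 by rewrite qpolarvv qf2 mulr0.
exists e3, f1, f2, g; split.
  apply: contraNneq (yE (B y f1) (B y e1) (B y f2) (B y e3)) => g0.
  rewrite -subr_eq0 -g0 gE !scaleNr !opprD !addrA; apply/eqP; congr (_ + _).
split; split=> //; rewrite gE !form_simp.
- by rewrite B11 (qpolarC _ f1) B1f (qpolarC _ e3) B13 (qpolarC _ f2) B1f2; ring.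
- by rewrite B1f Bff (qpolarC _ e3) Bf3 (qpolarC _ f2) Bff2; ring.
- by rewrite B13 Bf3 B33 (qpolarC _ f2) B3f; ring.
- by rewrite B1f2 Bff2 B3f f2f2; ring.
Qed.

(** Rescaling f1 and f2 by c = Q g makes the form proportional to one that does
    not depend on A.  Here c != 0, as otherwise g would span a singular
    point of the quadric. *)
Lemma quadric_normal_form (e1 e2 : 'rV[F]_5) :
    row_free (col_mx e1 e2) -> Q e1 = 0 -> Q e2 = 0 -> B e1 e2 = 0 ->
  exists2 M : 'M[F]_5, M \in unitmx & exists2 c, c != 0 & forall x : 'rV[F]_5,
    Q (x *m M) = c * (x 0 (inord 0) * x 0 (inord 1) +
                      x 0 (inord 2) * x 0 (inord 3) + x 0 (inord 4) ^+ 2).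
Proof.
move=> fe q1 q2 B12; have [e3 [f1 [f2 [g [g0 hf]]]]] := witt_basis fe q1 q2 B12.
have Mu := hyperbolic_frame_unit (oner_neq0 _) g0 hf.
have c0 : Q g != 0.
  apply/eqP => qg; have [w] := hA g0 qg.
  rewrite -[w](mulmxKV Mu) mul_frame !form_simp.
  have [_ _ _ [-> -> -> ->]] := hf; rewrite qpolarvv qg.
  by rewrite !(mulr0, addr0) eqxx.
pose c := Q g.
have hf' : hyperbolic_frame c e1 (c *: f1) e3 (c *: f2) g.
  case: hf => [[? qf1 ? qf2]] [h1 h2] [o1 o2 o3 o4] [g1 g2 g3 g4].
  by split; split; rewrite ?form_simp ?h1 ?h2 ?o1 ?o2 ?o3 ?o4 ?g1 ?g2 ?g3 ?g4
    ?qf1 ?qf2 ?mulr0 ?mulr1.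
exists (frame e1 (c *: f1) e3 (c *: f2) g).
  exact: hyperbolic_frame_unit c0 g0 hf'.
by exists c => // x; rewrite (qform_frame _ hf') /c; ring.
Qed.
End Witt.

(** * The spin representation *)

(** The symplectic form with its second argument fixed, as a column: polar
    planes are then kernels of matrices, and rank lemmas apply to them. *)
Definition symp_dual (F : fieldType) (b : 'rV[F]_4) : 'cV[F]_4 :=
  \col_i [:: b 0 (inord 1); - b 0 (inord 0); b 0 (inord 3); - b 0 (inord 2)]`_i.

Definition symp (F : fieldType) (a b : 'rV[F]_4) : F := (a *m symp_dual b) 0 0.

Lemma sympE (F : fieldType) (a b : 'rV[F]_4) : symp a b =
  a 0 (inord 0) * b 0 (inord 1) - a 0 (inord 1) * b 0 (inord 0) +
  a 0 (inord 2) * b 0 (inord 3) - a 0 (inord 3) * b 0 (inord 2).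
Proof. by rewrite /symp mxE sum_ord4 !mxE !inordK //=; ring. Qed.

Lemma sympDl (F : fieldType) (a b c : 'rV[F]_4) :
  symp (a + b) c = symp a c + symp b c.
Proof. by rewrite /symp mulmxDl mxE. Qed.

Lemma sympZl (F : fieldType) k (a c : 'rV[F]_4) : symp (k *: a) c = k * symp a c.
Proof. by rewrite /symp -scalemxAl mxE. Qed.

Lemma sympC (F : fieldType) (a b : 'rV[F]_4) : symp a b = - symp b a.
Proof. by rewrite !sympE; ring. Qed.

Lemma sympDr (F : fieldType) (a b c : 'rV[F]_4) :
  symp c (a + b) = symp c a + symp c b.
Proof. by rewrite sympC sympDl opprD -!(sympC c). Qed.

Lemma sympZr (F : fieldType) k (a c : 'rV[F]_4) : symp c (k *: a) = k * symp c a.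
Proof. by rewrite sympC sympZl -mulrN -(sympC c). Qed.

Lemma sympvv (F : fieldType) (a : 'rV[F]_4) : symp a a = 0.
Proof. by rewrite sympE; ring. Qed.

Lemma symp0l (F : fieldType) (a : 'rV[F]_4) : symp 0 a = 0.
Proof. by rewrite -(scale0r 0) sympZl mul0r. Qed.

Lemma symp0r (F : fieldType) (a : 'rV[F]_4) : symp a 0 = 0.
Proof. by rewrite -(scale0r 0) sympZr mul0r. Qed.

Lemma symp_dual_eq0 (F : fieldType) (b : 'rV[F]_4) :
  (symp_dual b == 0) = (b == 0).
Proof.
apply/eqP/eqP => [/colP H|->]; last first.
  by apply/colP; apply: ord4_ind; rewrite !mxE inordK //= ?oppr0.
have [h0 h1 h2 h3] :=
  And4 (H (inord 0)) (H (inord 1)) (H (inord 2)) (H (inord 3)).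
rewrite !mxE !inordK //= in h0 h1 h2 h3.
apply/rowP; apply: ord4_ind; rewrite mxE //.
  by apply/eqP; rewrite -oppr_eq0 h1.
by apply/eqP; rewrite -oppr_eq0 h3.
Qed.

Lemma symp_eq0 (F : fieldType) (a b : 'rV[F]_4) :
  (a *m symp_dual b == 0) = (symp a b == 0).
Proof.
apply/eqP/eqP => [H|H]; first by rewrite /symp H mxE.
by rewrite [LHS]mx11_scalar -/(symp a b) H raddf0.
Qed.

Lemma symp_dual_surj (F : fieldType) (g : 'cV[F]_4) : exists b, g = symp_dual b.
Proof.
exists (\row_i [:: - g (inord 1) 0; g (inord 0) 0;
                   - g (inord 3) 0; g (inord 2) 0]`_i).
by apply/colP; apply: ord4_ind; rewrite !mxE !inordK //= ?opprK.
Qed.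

Lemma symp_nondeg (F : fieldType) (a : 'rV[F]_4) :
  (forall c, symp a c = 0) -> a = 0.
Proof.
move=> H; apply/eqP; rewrite -symp_dual_eq0; apply/eqP/colP => i.
have /eqP := H (delta_mx 0 i).
by rewrite sympC oppr_eq0 /symp -rowE !mxE => /eqP.
Qed.

(** For column spinors this is the block matrix with diagonal blocks x4 and - x4
    and off-diagonal blocks N and adj N, where N has rows (x0, x2), (- x3, x1)
    and determinant x0 x1 + x2 x3.  It is transposed, as spinors are rows. *)
Definition gamma (F : fieldType) (x : 'rV[F]_5) : 'M[F]_4 :=
  let x0 := x 0 (inord 0) in let x1 := x 0 (inord 1) in
  let x2 := x 0 (inord 2) in let x3 := x 0 (inord 3) in
  let x4 := x 0 (inord 4) in
  \matrix_(i, j) (nth [::] [:: [:: x4; 0; x1; x3];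
                               [:: 0; x4; - x2; x0];
                               [:: x0; - x3; - x4; 0];
                               [:: x2; x1; 0; - x4]] i)`_j.

Lemma gamma_is_linear (F : fieldType) : linear (@gamma F).
Proof.
move=> k x y; apply/matrixP; apply: ord4_ind; apply: ord4_ind;
  rewrite !mxE !inordK //=; ring.
Qed.

HB.instance Definition _ (F : fieldType) :=
  GRing.isLinear.Build F 'rV[F]_5 'M[F]_4 *:%R (@gamma F) (@gamma_is_linear F).

Lemma mul_gamma (F : fieldType) (a : 'rV[F]_4) (x : 'rV[F]_5) :
  a *m gamma x = \row_j
    let x0 := x 0 (inord 0) in let x1 := x 0 (inord 1) in
    let x2 := x 0 (inord 2) in let x3 := x 0 (inord 3) in
    let x4 := x 0 (inord 4) in
    let a0 := a 0 (inord 0) in let a1 := a 0 (inord 1) in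
    let a2 := a 0 (inord 2) in let a3 := a 0 (inord 3) in
    [:: x4 * a0 + x0 * a2 + x2 * a3;
        x4 * a1 - x3 * a2 + x1 * a3;
        x1 * a0 - x2 * a1 - x4 * a2;
        x3 * a0 + x0 * a1 - x4 * a3]`_j.
Proof.
apply/rowP; apply: ord4_ind; rewrite !mxE sum_ord4 !mxE !inordK //=; ring.
Qed.

Lemma gamma_square (F : fieldType) (x : 'rV[F]_5) : gamma x *m gamma x =
  (x 0 (inord 0) * x 0 (inord 1) + x 0 (inord 2) * x 0 (inord 3) +
   x 0 (inord 4) ^+ 2)%:M.
Proof.
apply/matrixP; apply: ord4_ind; apply: ord4_ind;
  rewrite !mxE sum_ord4 !mxE -!val_eqE /= !inordK //=; ring.
Qed.

Lemma gamma_selfadjoint (F : fieldType) (x : 'rV[F]_5) a b :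
  symp (a *m gamma x) b = symp a (b *m gamma x).
Proof. rewrite !mul_gamma !sympE !mxE !inordK //=; ring. Qed.

Lemma gamma_alternating (F : fieldType) (x : 'rV[F]_5) a :
  symp (a *m gamma x) a = 0.
Proof. rewrite !mul_gamma !sympE !mxE !inordK //=; ring. Qed.

(** The coordinates of x are the Plucker coordinates of the line <a, b>.  There
    are six of those; the two that would both have to be x4 agree because
    symp a b = 0. *)
Lemma gamma_rank2 (F : fieldType) (a b : 'rV[F]_4) : symp a b = 0 ->
  exists x, forall c, c *m gamma x = symp b c *: a - symp a c *: b.
Proof.
move=> ab.
pose x0 := a 0 (inord 3) * b 0 (inord 0) - a 0 (inord 0) * b 0 (inord 3).
pose x1 := a 0 (inord 1) * b 0 (inord 2) - a 0 (inord 2) * b 0 (inord 1).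
pose x2 := a 0 (inord 0) * b 0 (inord 2) - a 0 (inord 2) * b 0 (inord 0).
pose x3 := a 0 (inord 1) * b 0 (inord 3) - a 0 (inord 3) * b 0 (inord 1).
pose x4 := a 0 (inord 1) * b 0 (inord 0) - a 0 (inord 0) * b 0 (inord 1).
exists (\row_i [:: x0; x1; x2; x3; x4]`_i) => c.
have x4E : x4 = a 0 (inord 2) * b 0 (inord 3) - a 0 (inord 3) * b 0 (inord 2).
  by apply/eqP; rewrite eq_sym -subr_eq0 -ab sympE /x4; apply/eqP; ring.
rewrite mul_gamma; apply/rowP; apply: ord4_ind; rewrite !mxE !inordK //= !sympE;
  rewrite /x0 /x1 /x2 /x3; first [by rewrite /x4; ring | by rewrite x4E; ring].
Qed.

(** * Lines of the quadric as points of PG(3,q) *)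

(** Totally singular subspaces of the quadratic space of dimension 5 have rank
    r <= 2.  The polar form maps R to r independent linear forms because the
    quadric is non-singular, and all these forms vanish on R: hence 2r <= 5. *)
Lemma isotropic_free (F : finFieldType) (A : 'M[F]_5) r (R : 'M[F]_(r, 5)) :
  nonsingular A -> row_free R ->
  (forall u : 'rV_5, (u <= R)%MS -> qform A u = 0) -> (r <= 2)%N.
Proof.
move=> hA Rfree R0; pose G := A + A^T.
have RGR : R *m G *m R^T = 0.
  apply/matrixP => i j.
  have : qpolar A (row i R) (row j R) = 0.
    by rewrite /qpolar !R0 ?addmx_sub ?row_sub ?subr0.
  rewrite qpolarE tr_row -row_mul colE mulmxA -row_mul -colE.
  by rewrite [in LHS]mxE [in LHS]mxE => ->; rewrite mxE.
have RGfree : row_free (R *m G).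
  rewrite -kermx_eq0; apply/rowV0P => x /sub_kermxP; rewrite mulmxA => xRG.
  apply/eqP; rewrite -(mulmx_free_eq0 _ Rfree); apply: contraT => u0.
  have [v] := hA _ u0 (R0 _ (submxMl _ _)).
  by rewrite qpolarE xRG mul0mx mxE eqxx.
have := mulmx0_rank_max RGR; rewrite mxrank_tr (eqP RGfree) (eqP Rfree).
by case: r {R Rfree R0 RGR RGfree} => [|[|[|r]]] //; rewrite !addnS.
Qed.

Lemma isotropic_rank (F : finFieldType) (A : 'M[F]_5) m (V : 'M[F]_(m, 5)) :
  nonsingular A -> (forall u : 'rV_5, (u <= V)%MS -> qform A u = 0) ->
  (\rank V <= 2)%N.
Proof.
move=> hA V0; apply: (isotropic_free hA (row_base_free V)) => u.
by rewrite eq_row_base; apply: V0.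
Qed.

Section SpinLines.
Variables (F : finFieldType) (A : 'M[F]_5) (S : {linear 'rV[F]_5 -> 'M[F]_4}).

(** The properties of gamma that the geometry needs; they do not refer to
    coordinates of the quadratic space. *)
Definition spin_map :=
  [/\ exists2 k, k != 0 & forall v, S v *m S v = (k * qform A v)%:M,
      forall v a b, symp (a *m S v) b = symp a (b *m S v),
      forall v a, symp (a *m S v) a = 0 &
      forall a b, symp a b = 0 ->
        exists v, forall c, c *m S v = symp b c *: a - symp a c *: b].

Definition spin_line (a : 'rV[F]_4) : {vspace 'rV[F]_5} :=
  rowspan (kermx (lin1_mx (mulmx a \o S))).

Lemma mem_spin_line a v : (v \in spin_line a) = (a *m S v == 0).
Proof. by rewrite mem_kernel mul_rV_lin1. Qed.

Lemma spin_lineZ k a : k != 0 -> spin_line (k *: a) = spin_line a.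
Proof.
move=> k0; apply/vspaceP => v.
by rewrite !mem_spin_line -scalemxAl scaler_eq0 (negPf k0).
Qed.

Hypotheses (hA : nonsingular A) (hS : spin_map).

Lemma clifford : exists2 k, k != 0 & forall u v,
  S u *m S v + S v *m S u = (k * qpolar A u v)%:M.
Proof.
have [[k k0 SS] _ _ _] := hS; exists k => // u v.
have := SS (u + v); rewrite qformD linearD /= mulmxDl !mulmxDr !SS => H.
have scD (x y : F) : (x + y)%:M = x%:M + y%:M :> 'M_4 by exact: raddfD.
move: H; rewrite !mulrDr !scD => H.
apply: (addrI ((k * qform A u)%:M + (k * qform A v)%:M)).
rewrite -{}H -!addrA; congr (_ + _).
by rewrite addrC -addrA.
Qed.

Lemma spin_square0 v : qform A v = 0 -> S v *m S v = 0.
Proof. by have [[k _ ->] _ _ _] := hS => ->; rewrite mulr0 raddf0. Qed.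

Lemma spin_eq0 v : S v = 0 -> v = 0.
Proof.
move=> Sv; have scalar0 (c : F) : c%:M = 0 :> 'M_4 -> c = 0.
  by move/(congr1 (fun M : 'M_4 => M 0 0)); rewrite !mxE eqxx.
have [[k k0 SS] _ _ _] := hS; have [k' k'0 cl] := clifford.
apply/eqP; apply: contraT => v0.
have qv : qform A v = 0.
  have := SS v; rewrite Sv mul0mx => /esym/scalar0/eqP.
  by rewrite mulf_eq0 (negPf k0) => /eqP.
have [w] := hA v0 qv; have := cl v w; rewrite Sv mul0mx mulmx0 addr0.
by move/esym/scalar0/eqP; rewrite mulf_eq0 (negPf k'0) /= => ->.
Qed.

Lemma spin_line_isotropic a v : a != 0 -> v \in spin_line a -> qform A v = 0.
Proof.
have [[k k0 SS] _ _ _] := hS; rewrite mem_spin_line => a0 /eqP aS.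
have /eqP : (k * qform A v) *: a = 0.
  by rewrite -mul_mx_scalar -SS mulmxA aS mul0mx.
by rewrite scaler_eq0 (negPf a0) orbF mulf_eq0 (negPf k0) => /eqP.
Qed.

(** The line is totally singular, so its rank is at most 2.  Conversely a S(v)
    always lies in the polar plane of a, of rank 3, so the kernel of
    v -> a S(v) has rank at least 5 - 3. *)
Lemma dim_spin_line a : a != 0 -> \dim (spin_line a) = 2%N.
Proof.
move=> a0; apply/eqP; rewrite eqn_leq; apply/andP; split.
  rewrite dim_rowspan; apply: (isotropic_rank hA) => u.
  by rewrite -mem_rowspan; apply: spin_line_isotropic.
rewrite dim_rowspan mxrank_ker.
have := @mulmx0_rank_max _ _ _ _ (lin1_mx (mulmx a \o S)) (symp_dual a).
rewrite rank_col symp_dual_eq0 a0 addn1 => H.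
suff: (\rank (lin1_mx (mulmx a \o S)) <= 3)%N by case: (\rank _) => [|[|[|[|]]]].
rewrite -ltnS; apply: H; apply/row_matrixP => i.
rewrite row_mul rowE mul_rV_lin1 row0; apply/eqP; rewrite symp_eq0 /=.
by have [_ _ -> _] := hS.
Qed.

Lemma spin_line_Q4 a : a != 0 -> is_Q4_line A (spin_line a).
Proof.
move=> a0; split; first by rewrite /is_line dim_spin_line.
by move=> v; apply: spin_line_isotropic.
Qed.

(** Suppose S x S y = 0 and let z satisfy B(x, z) = 1.  After subtracting a
    multiple of x from y, S y anticommutes with S z, so k S y, which is
    (S x S z + S z S x) S y, equals - S x S y S z = 0.  But S is injective
    because the quadric is non-singular. *)
Lemma spin_mul_neq0 x y : row_free (col_mx x y) -> qform A x = 0 ->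
  S x *m S y != 0.
Proof.
move=> fxy qx; apply/eqP => xy0.
have x0 : x != 0 := free2_neq0 fxy; move/free2P: fxy => fxy.
have [z xz] := hyperbolic_partner hA x0 qx; have [k k0 cl] := clifford.
pose y' := y + (- qpolar A y z) *: x.
have xy' : S x *m S y' = 0.
  rewrite linearD linearZ /= mulmxDr -scalemxAr xy0 spin_square0 //.
  by rewrite scaler0 addr0.
have y'z : qpolar A y' z = 0 by rewrite /y' !form_simp xz; ring.
have : k *: S y' = 0.
  rewrite -mul_scalar_mx -[k]mulr1 -xz -cl mulmxDl -!mulmxA xy' mulmx0 addr0.
  have /eqP := cl y' z; rewrite y'z mulr0 raddf0 addrC addr_eq0 => /eqP ->.
  by rewrite mulmxN mulmxA xy' mul0mx oppr0.
move/eqP; rewrite scaler_eq0 (negPf k0) /= => /eqP Sy'.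
move: (spin_eq0 Sy'); rewrite /y' addrC -[y]scale1r => /fxy[_ /eqP].
by rewrite oner_eq0.
Qed.

(** If x and y span the line, then S x and S y anticommute and have square zero,
    so each nonzero row of S x S y is killed by both. *)
Lemma spin_line_surj l : is_Q4_line A l -> exists2 a, a != 0 & l = spin_line a.
Proof.
case=> /rowspanP_dim[C /eqP rC lC] lQ.
have [x [y fxy Cxy]] := rank2_basis rC.
have lE v : (v \in l) = (v <= col_mx x y)%MS by rewrite lC mem_rowspan Cxy.
have xl : x \in l by rewrite lE span2l.
have yl : y \in l by rewrite lE span2r.
have [qx qy] : qform A x = 0 /\ qform A y = 0 by split; apply: lQ.
have Bxy : qpolar A x y = 0 by rewrite /qpolar qx qy lQ ?memvD // !subr0.
have [k k0 cl] := clifford.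
have SxSy : S y *m S x = - (S x *m S y).
  by apply/eqP; rewrite -addr_eq0 cl qpolarC Bxy mulr0 raddf0.
have [i i0] : exists i, row i (S x *m S y) != 0.
  have := spin_mul_neq0 fxy qx; rewrite -submx0 => /row_subPn[i].
  by rewrite submx0; exists i.
pose a := row i (S x *m S y).
have aE : a = row i (S x) *m S y by rewrite /a row_mul.
exists a => //; apply/eqP; rewrite eqEdim; apply/andP; split; last first.
  by rewrite dim_spin_line // lC dim_rowspan rC.
have ax : a *m S x = 0.
  rewrite /a -row_mul -mulmxA SxSy mulmxN mulmxA spin_square0 //.
  by rewrite mul0mx oppr0 row0.
have ay : a *m S y = 0 by rewrite aE -mulmxA spin_square0 // mulmx0.
apply/subvP => v; rewrite lE mem_spin_line => /span2P[al [be ->]].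
by rewrite linearD !linearZ /= mulmxDr -!scalemxAr ax ay !scaler0 addr0.
Qed.

(** Let x span a common point and B(x, z) = 1.  As a S x = 0, the Clifford
    relation gives k a = (a S z) S x; then S x moves over to b and kills it. *)
Lemma meet_symp a b :
  a != 0 -> lines_meet (spin_line a) (spin_line b) -> symp a b = 0.
Proof.
move=> a0 [p [/pointP[x x0 ->]]]; rewrite -!memvE => xa.
have qx := spin_line_isotropic a0 xa; move: xa.
rewrite !mem_spin_line => /eqP ax /eqP bx.
have [z xz] := hyperbolic_partner hA x0 qx; have [k k0 cl] := clifford.
have aE : k *: a = a *m S z *m S x.
  by rewrite -mul_mx_scalar -[k]mulr1 -xz -cl mulmxDr !mulmxA ax mul0mx add0r.
have : k * symp a b = 0.
  by rewrite -sympZl aE; case: hS => _ -> _ _; rewrite bx symp0r.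
by move/eqP; rewrite mulf_eq0 (negPf k0) => /eqP.
Qed.

Lemma rank_symp_duals (a b : 'rV[F]_4) : row_free (col_mx a b) ->
  \rank (row_mx (symp_dual a) (symp_dual b)) = 2%N.
Proof.
move=> fab; rewrite -mxrank_tr tr_row_mx; apply/eqP; apply/free2P => al be E.
  have /free2P := fab; apply; apply: symp_nondeg => v.
  rewrite sympDl !sympZl.
  have := congr1 (fun M : 'rV_4 => (M *m v^T) 0 0) E.
  rewrite mulmxDl -!scalemxAl mul0mx -!trmx_mul !mxE => E'.
  apply/eqP; rewrite -oppr_eq0 -[X in _ == X]E' !(sympC _ v) /symp; apply/eqP.
  by rewrite !mxE; ring.
Qed.

(** The span of a and b is contained in its orthogonal space, and both have
    rank 2. *)
Lemma isotropic_span_perp (a b c : 'rV[F]_4) :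
  row_free (col_mx a b) -> symp a b = 0 ->
  symp a c = 0 -> symp b c = 0 -> (c <= col_mx a b)%MS.
Proof.
move=> fab ab ac bc; pose K := row_mx (symp_dual a) (symp_dual b).
have Ker v : symp a v = 0 -> symp b v = 0 -> v *m K = 0.
  move=> av bv; rewrite mul_mx_row -row_mx0; congr row_mx; apply/eqP;
    by rewrite symp_eq0 sympC ?av ?bv oppr0.
have abK : (col_mx a b <= kermx K)%MS.
  by apply/sub_kermxP; rewrite mul_col_mx !Ker ?sympvv ?col_mx0 // sympC ab oppr0.
have rK : \rank K = 2%N by apply: rank_symp_duals.
have /eqmxP -> : (col_mx a b == kermx K)%MS.
  by rewrite -(mxrank_leqif_eq abK) (eqP fab) mxrank_ker rK.
by apply/sub_kermxP/Ker.
Qed.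

(** The point P is the vector x for which S x is the rank-two map made from a
    and b; the kernel of S x is the orthogonal space of <a, b>, that is <a, b>
    itself. *)
Lemma pencil_of_isotropic_line (a b : 'rV[F]_4) :
  row_free (col_mx a b) -> symp a b = 0 ->
  exists2 P, is_Q4_point A P & forall l, is_Q4_line A l -> (P <= l)%VS ->
    exists2 c, c != 0 & (c <= col_mx a b)%MS /\ l = spin_line c.
Proof.
move=> fab ab; have [_ _ _ tr] := hS; have [x xE] := tr a b ab.
have /free2P fab' := fab.
have a0 : a != 0 := free2_neq0 fab.
have perp c : c *m S x = 0 -> symp a c = 0 /\ symp b c = 0.
  rewrite xE -scaleNr => /fab'[-> /eqP]; rewrite oppr_eq0 => /eqP ->.
  by split.
have x0 : x != 0.
  apply: contraNneq a0 => x0; apply/eqP; apply: symp_nondeg => c.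
  by have [] := perp c; rewrite // x0 linear0 mulmx0.
have xa : x \in spin_line a.
  by rewrite mem_spin_line xE sympvv scale0r subr0 sympC ab oppr0 scale0r.
exists <[x]>%VS.
  split; first by rewrite /is_point dim_vline x0.
  move=> v /vlineP[k ->]; rewrite qformZ (spin_line_isotropic a0 xa) mulr0 //.
move=> l /spin_line_surj[c c0 ->].
rewrite -memvE mem_spin_line => /eqP/perp[ac bc].
by exists c => //; split=> //; apply: isotropic_span_perp.
Qed.

(** If u were orthogonal to the whole line of b, then together they would span a
    totally singular subspace.  Its rank is at most 2, so u would lie on both
    lines, which do not meet. *)
Lemma spin_line_pairing a b u : b != 0 -> symp a b != 0 ->
  u \in spin_line a -> u != 0 -> exists2 v, v \in spin_line b & qpolar A u v = 1.
Proof.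
move=> b0 ab ua u0.
have a0 : a != 0 by apply: contraNneq ab => ->; rewrite symp0l.
suff: exists2 v, v \in spin_line b & qpolar A u v != 0.
  case=> v vb uv; exists ((qpolar A u v)^-1 *: v); first exact: memvZ.
  by rewrite qpolarZr mulVf.
apply: NNPP => nv; pose K := kermx (lin1_mx (mulmx b \o S)).
have KE v : (v <= K)%MS = (v \in spin_line b) by rewrite mem_rowspan.
have rK : \rank K = 2%N by rewrite -dim_rowspan -/(spin_line b) dim_spin_line.
have rV : (\rank (u + K)%MS <= 2)%N.
  apply: (isotropic_rank hA) => w /sub_addsmxP[[x y] ->] /=.
  rewrite [x]mx11_scalar mul_scalar_mx.
  have yb : y *m K \in spin_line b by rewrite -KE submxMl.
  rewrite !form_simp (spin_line_isotropic a0 ua) (spin_line_isotropic b0 yb).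
  have -> : qpolar A u (y *m K) = 0.
    by apply/eqP; apply: contraT => uy; case: nv; exists (y *m K).
  by ring.
have uK : (u <= K)%MS.
  have KV : (K <= u + K)%MS := addsmxSr u K.
  have /eqmxP KE' : (K == u + K)%MS.
    by rewrite -(mxrank_leqif_eq KV) eqn_leq mxrankS // rK rV.
  by rewrite KE' addsmxSl.
move: ab; rewrite (@meet_symp a b) ?eqxx //.
exists <[u]>%VS; rewrite -!memvE; split=> //; last by rewrite -KE.
by rewrite /is_point dim_vline u0.
Qed.

Lemma lines_meet_self l : is_line l -> @lines_meet F 5 l l.
Proof.
move=> ll; exists <[vpick l]>%VS; rewrite -memvE memv_pick; split=> //.
rewrite /is_point dim_vline vpick0; have [l0|//] := eqVneq l 0%VS.
by move: ll; rewrite l0 /is_line dimv0.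
Qed.

(** The lines of a and b are opposite, so they have bases dual to each other for
    the polar form; on their span H the quadratic form is then x0 x1 + x2 x3.
    The same H is the kernel of v -> symp (a S v) b.  This linear form vanishes
    on the line of each combination of a and b, because symp (c S v) c = 0 for
    every c. *)
Lemma hyperbolic_solid (a b : 'rV[F]_4) :
  row_free (col_mx a b) -> symp a b != 0 ->
  exists2 H, is_hyperbolic_section A H &
    forall c, (c <= col_mx a b)%MS -> c != 0 -> (spin_line c <= H)%VS.
Proof.
move=> fab ab; have [_ sa alt _] := hS.
have a0 : a != 0 by apply: contraNneq ab => ->; rewrite symp0l.
have b0 : b != 0 by apply: contraNneq ab => ->; rewrite symp0r.
pose N := lin1_mx (mulmx a \o S).
have NE v : v *m N = a *m S v by rewrite mul_rV_lin1.
pose h := N *m symp_dual b; pose H := rowspan (kermx h).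
have HE v : (v \in H) = (symp (a *m S v) b == 0).
  by rewrite mem_kernel mulmxA NE symp_eq0.
have cH c : (c <= col_mx a b)%MS -> c != 0 -> (spin_line c <= H)%VS.
  move=> /span2P[al [be cE]] c0; apply/subvP => v.
  rewrite mem_spin_line HE => /eqP.
  rewrite cE mulmxDl -!scalemxAl => /eqP; rewrite addr_eq0 => /eqP aE.
  have h1 : al * symp (a *m S v) b = 0.
    by rewrite -sympZl aE -scaleNr sympZl alt mulr0.
  have h2 : be * symp (a *m S v) b = 0.
    rewrite sa -sympZr -[be *: _]opprK -aE -scaleNr sympZr sympC alt.
    by rewrite oppr0 mulr0.
  apply: contraNT c0 => hv; rewrite cE.
  move/eqP: h1; rewrite mulf_eq0 (negPf hv) orbF => /eqP ->.
  move/eqP: h2; rewrite mulf_eq0 (negPf hv) orbF => /eqP ->.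
  by rewrite !scale0r addr0.
have aH : (spin_line a <= H)%VS.
  by apply: cH a0; apply: span2l.
have bH : (spin_line b <= H)%VS.
  by apply: cH b0; apply: span2r.
have rN : \rank N = 3%N.
  have := dim_spin_line a0; rewrite dim_rowspan mxrank_ker -/N.
  by have := rank_leq_row N; case: (\rank N) => [|[|[|[|[|[|]]]]]].
(* Otherwise N, of rank 3, would have its image in the orthogonal space of
   <a, b>, which has rank 2. *)
have h0 : h != 0.
  apply/eqP => hb.
  suff /mulmx0_rank_max : N *m row_mx (symp_dual a) (symp_dual b) = 0.
    by rewrite rN rank_symp_duals.
  rewrite mul_mx_row [N *m symp_dual b]hb -row_mx0; congr row_mx.
  apply/row_matrixP => i; rewrite row_mul rowE NE row0; apply/eqP.
  by rewrite symp_eq0 alt.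
have dH : \dim H = 4%N by rewrite dim_rowspan mxrank_ker rank_col h0.
have isoa := spin_line_isotropic a0; have isob := spin_line_isotropic b0.
(* The basis p, r of the line of a and the basis s, t of the line of b are
   dual to each other. *)
have [p pa p0] : exists2 p, p \in spin_line a & p != 0.
  exists (vpick (spin_line a)); first exact: memv_pick.
  by rewrite vpick0 -dimv_eq0 dim_spin_line.
have [s sb ps] := spin_line_pairing b0 ab pa p0.
have [r0 r0a r0p] : exists2 r, r \in spin_line a & r \notin <[p]>%VS.
  apply/subvPn/negP => /dimvS; rewrite dim_spin_line // dim_vline.
  by case: (_ != 0).
have [r rE] : exists r, r = r0 + (- qpolar A r0 s) *: p by eexists.
have ra : r \in spin_line a by rewrite rE memvD ?memvZ.
have rn0 : r != 0.
  apply: contraNneq r0p => r00; apply/vlineP; exists (qpolar A r0 s).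
  by apply/eqP; rewrite -subr_eq0 -scaleNr -rE r00.
have rs : qpolar A r s = 0 by rewrite rE !form_simp ps; ring.
have [t0 t0b rt0] := spin_line_pairing b0 ab ra rn0.
have [t tE] : exists t, t = t0 + (- qpolar A p t0) *: s by eexists.
have tb : t \in spin_line b by rewrite tE memvD ?memvZ.
have pt : qpolar A p t = 0 by rewrite tE !form_simp ps; ring.
have rt : qpolar A r t = 1 by rewrite tE !form_simp rt0 rs; ring.
have pr : qpolar A p r = 0 by rewrite /qpolar !isoa ?memvD // !subr0.
have st : qpolar A s t = 0 by rewrite /qpolar !isob ?memvD // !subr0.
have [qp qr qs qt] := And4 (isoa _ pa) (isoa _ ra) (isob _ sb) (isob _ tb).
pose e := [tuple p; s; r; t].
have eE (x : 'rV[F]_4) : \sum_(i < 4) x 0 i *: tnth e i =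
    x 0 (inord 0) *: p + x 0 (inord 1) *: s +
    x 0 (inord 2) *: r + x 0 (inord 3) *: t.
  by rewrite sum_ord4 !(tnth_nth 0) !inordK.
exists H => //; exists e; last first.
  move=> x; rewrite eE !form_simp qp qr qs qt ps pt pr rt (qpolarC _ s r) rs st.
  by split=> E; rewrite -[RHS]E; ring.
rewrite basisEfree; apply/and3P; split; last by rewrite dH.
  apply/freeP => k k0 i.
  have := eE (\row_i k i); rewrite (eq_bigr (fun i => k i *: e`_i)); last first.
    by move=> j _; rewrite mxE (tnth_nth 0).
  rewrite {}k0 !mxE => E.
  have pair w : qpolar A (k (inord 0) *: p + k (inord 1) *: s +
                          k (inord 2) *: r + k (inord 3) *: t) w = 0.
    by rewrite -E -(scale0r 0) qpolarZl mul0r.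
  move: i; apply: ord4_ind.
  - by rewrite -(pair s) !form_simp ps rs (qpolarC _ t) st qpolarvv qs; ring.
  - rewrite -(pair p) !form_simp (qpolarC _ s) ps (qpolarC _ r) pr (qpolarC _ t).
    by rewrite pt qpolarvv qp; ring.
  - by rewrite -(pair t) !form_simp pt st rt qpolarvv qt; ring.
  - rewrite -(pair r) !form_simp pr (qpolarC _ s) rs (qpolarC _ t) rt qpolarvv.
    by rewrite qr; ring.
apply/span_subvP => x; rewrite !inE => /or4P[] /eqP ->;
  by [exact: (subvP aH) | exact: (subvP bH)].
Qed.

(** Distinct points of the line <a, b> are not orthogonal, so the corresponding
    lines do not meet; as there are q + 1 of them, they form a regulus. *)
Lemma regulus_of_hyperbolic_line (a b : 'rV[F]_4) :
  row_free (col_mx a b) -> symp a b != 0 ->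
  exists2 R, is_regulus_in_Q4 A R & forall l, l \in R ->
    exists2 c, c != 0 & (c <= col_mx a b)%MS /\ l = spin_line c.
Proof.
move=> fab ab; have [H Hh cH] := hyperbolic_solid fab ab.
(* The points of the line <a, b>, parametrised by the projective line. *)
pose pt (t : option F) := if t is Some t then a + t *: b else b.
have ba : symp b a = - symp a b by rewrite sympC.
have pt_symp t s : t != s -> symp (pt t) (pt s) != 0.
  case: t s => [t|] [s|] //= ts.
  - have -> : symp (a + t *: b) (a + s *: b) = (s - t) * symp a b.
      by rewrite !(sympDl, sympZl, sympDr, sympZr) !sympvv ba; ring.
    by rewrite mulf_neq0 // subr_eq0; apply: contraNneq ts => ->.
  - by rewrite sympDl sympZl sympvv mulr0 addr0.
  by rewrite sympDr sympZr sympvv mulr0 addr0 ba oppr_eq0.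
have pt0 t : pt t != 0.
  have [s ts] : exists s, t != s.
    by case: (t) => [?|]; [exists None|exists (Some 0)].
  by apply: contraNneq (pt_symp _ _ ts) => ->; rewrite symp0l.
have pt_ab t : (pt t <= col_mx a b)%MS.
  case: t => [t|]; last exact: span2r.
  by apply/span2P; exists 1, t; rewrite scale1r.
have nomeet t s : t != s -> ~ lines_meet (spin_line (pt t)) (spin_line (pt s)).
  by move=> ts /(meet_symp (pt0 t)) E; move: (pt_symp _ _ ts); rewrite E eqxx.
have inj : injective (fun t => spin_line (pt t)).
  move=> t s E; apply/eqP; apply: contraT => /nomeet; rewrite E; case.
  by apply: lines_meet_self; have [] := spin_line_Q4 (pt0 s).
exists [fset spin_line (pt t) | t in {: option F}]%fset; last first.
  by move=> _ /imfsetP[t /= _ ->]; exists (pt t).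
exists H => //; split.
- by rewrite card_imfset //= -cardE card_option.
- move=> _ /imfsetP[t /= _ ->]; split; first exact: spin_line_Q4.
  exact: cH.
move=> _ _ /imfsetP[t /= _ ->] /imfsetP[s /= _ ->] ts.
by apply: nomeet; apply: contraNneq ts => ->.
Qed.

End SpinLines.

(** * Sets of lines that meet every line *)

Lemma spin_map_exists (F : finFieldType) (A : 'M[F]_5) (l : {vspace 'rV[F]_5}) :
  nonsingular A -> is_Q4_line A l -> exists S, spin_map A S.
Proof.
move=> hA [/rowspanP_dim[C /eqP/rank2_basis[x [y fxy Cxy]] lC] lQ].
have lE v : (v \in l) = (v <= col_mx x y)%MS by rewrite lC mem_rowspan Cxy.
have xl : x \in l by rewrite lE span2l.
have yl : y \in l by rewrite lE span2r.
have Bxy : qpolar A x y = 0 by rewrite /qpolar !lQ ?memvD // !subr0.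
have [M Mu [c c0 QM]] := quadric_normal_form hA fxy (lQ _ xl) (lQ _ yl) Bxy.
exists (@gamma F \o mulmxr (invmx M)).
split=> [|v a b|v a|a b /gamma_rank2[x' x'E]].
- exists c^-1 => [|v]; first by rewrite invr_eq0.
  have := QM (v *m invmx M); rewrite mulmxKV // => ->.
  by rewrite mulKf // gamma_square.
- exact: gamma_selfadjoint.
- exact: gamma_alternating.
by exists (x' *m M) => d; rewrite /= mulmxK.
Qed.

Theorem proposition1p1 (F : finFieldType) (A : 'M[F]_5) (hA : nonsingular A)
    (L : {fset {vspace 'rV[F]_5}})
    (hL : forall l, l \in L -> is_Q4_line A l)
    (hmeet : forall l, is_Q4_line A l -> exists2 m, m \in L & lines_meet l m)
    (B : {fset {vspace 'rV[F]_3}})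
    (hB : is_smallest_nontrivial_blocking_set B)
    (hLB : (#|` L| < #|` B|)%N) :
  (exists2 P, is_Q4_point A P &
     forall l, is_Q4_line A l -> (P <= l)%VS -> l \in L) \/
  (exists2 R, is_regulus_in_Q4 A R & (R `<=` L)%fset).
Proof.
have [[l0 l0Q]|noline] := classic (exists l, is_Q4_line A l); last first.
  left; have [v v0 qv] := isotropic_vector A.
  exists <[v]>%VS => [|l lQ]; last by case: noline; exists l.
  split; first by rewrite /is_point dim_vline v0.
  by move=> u /vlineP[k ->]; rewrite qformZ qv mulr0.
(* Otherwise the quadric has a line, and spinors are available. *)
have [S hS] := spin_map_exists hA l0Q.
(* kappa chooses a spinor for each line of L; the default 0 is used for no
   element of L. *)
pose kappa l := odflt 0 [pick a | (a != 0) && (spin_line S a == l)].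
have kappaP l : l \in L -> kappa l != 0 /\ spin_line S (kappa l) = l.
  move=> /hL/(spin_line_surj hA hS)[a a0 aE]; rewrite /kappa.
  case: pickP => [a' /andP[a'0 /eqP] //|/(_ a)].
  by rewrite a0 -aE eqxx.
pose X := [set x in [seq kappa l | l <- L]].
have XE x : x \in X -> exists2 l, l \in L & x = kappa l.
  by rewrite inE => /mapP[l lL ->]; exists l.
have XB : (#|X| < #|` B|)%N.
  apply: leq_ltn_trans hLB; rewrite cardsE; apply: leq_trans (card_size _) _.
  by rewrite size_map.
have Xb : blocks X.
  split=> [x /XE[l lL ->]|g]; first by have [] := kappaP l lL.
  (* Every plane is the polar plane of some b, and L has a line that meets the
     line of b. *)
  have [b ->] := symp_dual_surj g; rewrite symp_dual_eq0 => b0.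
  have [l lL bl] := hmeet _ (spin_line_Q4 hA hS b0).
  have [k0 lE] := kappaP l lL; exists (kappa l); first by rewrite inE map_f.
  apply/eqP; rewrite symp_eq0 sympC oppr_eq0 (meet_symp hA hS b0) //.
  by rewrite lE.
have [a [b fab Xab]] := small_solid_blocking hB Xb XB.
have inL c : c != 0 -> (c <= col_mx a b)%MS -> spin_line S c \in L.
  move=> c0 cab; have [_ /XE[l lL ->] /sub_rVP[k cE]] := Xab c cab c0.
  have k0 : k != 0 by apply: contraNneq c0 => k0; rewrite cE k0 scale0r.
  by rewrite cE spin_lineZ //; have [_ ->] := kappaP l lL.
have [ab|ab] := eqVneq (symp a b) 0.
  left; have [P PQ Pl] := pencil_of_isotropic_line hA hS fab ab.
  by exists P => // l lQ /(Pl l lQ)[c c0 [cab ->]]; apply: inL.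
right; have [R RQ Rl] := regulus_of_hyperbolic_line hA hS fab ab.
by exists R => //; apply/fsubsetP => l /Rl[c c0 [cab ->]]; apply: inL.
Qed.
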